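(* Let $l\in\{1,\dots,n-1\}$, let $\delta\ge 0$, and let $M$ be a (possibly randomized) stopping algorithm which is $(\varepsilon,\delta)$-differentially private with respect to $d_l$. For a given $\sigma\in\mathcal{S}_n$ let $q_{i,n}=\Pr[CM(\sigma,\tau)=\sigma_i]\in(0,1)$ for $i=1,\dots,n$. If there exists at least one pair $i,j\in\{1,\dots,n\}$ with $i\ne j$, $|i-j|\le l$, $q_{i,n}\ge q_{j,n}$ and $\delta<q_{i,n}-q_{j,n}$, then \[\varepsilon\ \ge\ \max_{\substack{1\le i,j\le n\\ |i-j|\le l}}\ln\left\{\frac{q_{i,n}-\delta}{q_{j,n}}\right\}.\] Otherwise $\varepsilon\ge 0$. These inequalities are tight.
   Context: Let $\mathcal{C}=\{C_1,\dots,C_n\}$ be a set of $n$ candidates. A qualification ordering is a permutation $\sigma=(\sigma_1,\dots,\sigma_n)$ of $\mathcal{C}$, meaning $\sigma_1>\dots>\sigma_n$ ($\sigma_k$ is the $k$-th best candidate); $\mathcal{S}_n$ is the set of qualification orderings. A time ordering is a permutation $\tau=(\tau_1,\dots,\tau_n)$ of $\mathcal{C}$ giving the arrival order; $\mathcal{T}_n$ is the set of time orderings and $\tau$ is chosen uniformly at random from $\mathcal{T}_n$. A stopping time is a map $M:\mathcal{S}_n\times\mathcal{T}_n\to\{1,\dots,n\}$ such that whether $M(\sigma,\tau)=t$ depends only on the relative order (under $\sigma$) of $\tau_1,\dots,\tau_t$; randomized stopping algorithms may additionally use independent internal randomness. $CM(\sigma,\tau):=\tau_{M(\sigma,\tau)}$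 is the selected candidate. For $l\in\{1,\dots,n-1\}$, $d_l(\sigma,\rho)$ is the minimum $k$ such that $\sigma=\pi_1\circ\cdots\circ\pi_k\circ\rho$ where each $\pi_i$ is a transposition of two elements at most $l$ positions apart in $\pi_{i+1}\circ\cdots\circ\pi_k\circ\rho$. $M$ is $(\varepsilon,\delta)$-differentially private w.r.t. $d_l$ if for all $S\subseteq\mathcal{C}$ and all $\sigma,\rho\in\mathcal{S}_n$ with $d_l(\sigma,\rho)\le1$: $\Pr[CM(\sigma,\tau)\in S]\le e^{\varepsilon}\Pr[CM(\rho,\tau)\in S]+\delta$.
   Formalization: Differential privacy is taken to include ε ≥ 0 (otherwise ''Otherwise ε ≥ 0'' fails, e.g. n=2, δ=1/2, always selecting the first candidate, ε=ln(1/2)); pairs with q_i ≤ δ, whose logarithm is undefined, are ignored in the maximum. *)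

(* Defs.v *)
From HB Require Import structures.
From mathcomp Require Import all_boot all_order all_algebra all_fingroup.
From mathcomp Require Import all_classical all_reals all_analysis.

Set Implicit Arguments.
Unset Strict Implicit.
Unset Printing Implicit Defensive.

Import Order.TTheory GRing.Theory Num.Theory.

Local Open Scope ring_scope.

(* Candidates are the elements of 'I_n. A qualification ordering is a
   permutation sigma with sigma k the (k+1)-st best candidate; a time ordering
   is a permutation tau with tau t the candidate arriving at time t+1. *)

Definition gap (n : nat) (i j : 'I_n) : nat := `|i%:Z - j%:Z|%N.

(* MathComp multiplies permutations from left to right, so rho * tperm a b is
   the composition (a b) o rho; a and b are candidates and rho^-1 gives their
   positions in rho. *)
Definition swap_step (l n : nat) (rho sigma : {perm 'I_n}) : bool :=
  [exists a : 'I_n, exists b : 'I_n,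
    [&& a != b, (gap ((rho^-1)%g a) ((rho^-1)%g b) <= l)%N
      & sigma == (rho * tperm a b)%g]].

Fixpoint swap_path (l n k : nat) (rho sigma : {perm 'I_n}) : bool :=
  if k is k'.+1 then
    [exists pi : {perm 'I_n}, swap_path l k' rho pi && swap_step l pi sigma]
  else sigma == rho.

Lemma swap_path_trans (l n j k : nat) (rho pi sigma : {perm 'I_n}) :
  swap_path l j rho pi -> swap_path l k pi sigma ->
  swap_path l (k + j) rho sigma.
Proof.
elim: k sigma => [|k IHk] sigma hj /=; first by move/eqP->.
case/existsP => s /andP[hk hs]; apply/existsP; exists s.
by rewrite hs andbT; exact: IHk.
Qed.

Lemma swap_path_tperm (l n m : nat) (x y : 'I_n) (rho : {perm 'I_n}) :
  (0 < l)%N -> y = (x + m)%N :> nat ->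
  exists k, swap_path l k rho (tperm x y * rho)%g.
Proof.
move=> hl; elim: m x y rho => [|m IHm] x y rho yE.
  have -> : y = x by apply: val_inj; rewrite /= yE addn0.
  by exists 0%N; rewrite /= tperm1 mul1g.
have step1 (z : 'I_n) (s : {perm 'I_n}) :
    y = z.+1 :> nat -> swap_path l 1 s (tperm z y * s)%g.
  move=> yz; apply/existsP; exists s; rewrite /= eqxx /=.
  apply/existsP; exists (s z); apply/existsP; exists (s y); apply/and3P; split.
  - by rewrite (inj_eq perm_inj) -val_eqE /= yz neq_ltn ltnSn.
  - by rewrite !permK /gap yz distnC -addn1 PoszD addrAC subrr add0r.
  - by rewrite -tpermJ conjgE !mulgA mulgV mul1g.
case: m IHm yE => [|m] IHm yE.
  by exists 1%N; apply: step1; rewrite yE addn1.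
have zn : (x + m.+1 < n)%N.
  by have := ltn_ord y; rewrite yE addnS; exact: ltnW.
pose z := Ordinal zn.
have yz : y = z.+1 :> nat by rewrite yE addnS.
have [k hk] := IHm x z (tperm z y * rho)%g erefl.
exists (1 + (k + 1))%N.
have xz : x != z by rewrite -val_eqE /= neq_ltn -{1}[X in (X < _)%N]addn0 ltn_add2l.
have yx : y != x by rewrite -val_eqE /= yE neq_ltn orbC -{1}[X in (X < _)%N]addn0 ltn_add2l.
have -> : (tperm x y * rho = tperm z y * (tperm x z * (tperm z y * rho)))%g.
  have := tpermJ x z (tperm z y).
  by rewrite tpermL tpermD 1?eq_sym 1?[x == y]eq_sym// conjgE tpermV => <-; rewrite !mulgA.
exact: swap_path_trans (swap_path_trans (step1 _ _ yz) hk) (step1 _ _ yz).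
Qed.

Lemma swap_path_exists (l n : nat) (rho sigma : {perm 'I_n}) :
  (0 < l)%N -> exists k, swap_path l k rho sigma.
Proof.
move=> hl.
have tp (x y : 'I_n) s : exists k, swap_path l k s (tperm x y * s)%g.
  have [xy|/ltnW yx] := leqP x y.
    by apply: (@swap_path_tperm l n (y - x)) => //; rewrite subnKC.
  by rewrite tpermC; apply: (@swap_path_tperm l n (x - y)) => //; rewrite subnKC.
have -> : sigma = (sigma * rho^-1 * rho)%g by rewrite mulgKV.
have [ts -> _] := prod_tpermP (sigma * rho^-1)%g.
elim: ts => [|t ts [k hk]].
  by exists 0%N; rewrite big_nil mul1g /=.
rewrite big_cons -mulgA.
have [k1 hk1] := tp t.1 t.2 (\prod_(t0 <- ts) tperm t0.1 t0.2 * rho)%g.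
by exists (k1 + k)%N; exact: swap_path_trans hk hk1.
Qed.

Definition swap_dist (l n : nat) (hl : (0 < l)%N)
    (sigma rho : {perm 'I_n}) : nat :=
  ex_minn (swap_path_exists rho sigma hl).

(* The candidates seen up to time t (0-based, inclusive) have the same pattern
   of relative ranks in the two instances. *)
Definition same_relative_order (n : nat) (t : 'I_n)
    (sigma tau sigma' tau' : {perm 'I_n}) : Prop :=
  forall s u : 'I_n, (s <= t)%N -> (u <= t)%N ->
    ((sigma^-1)%g (tau s) < (sigma^-1)%g (tau u))%N =
    ((sigma'^-1)%g (tau' s) < (sigma'^-1)%g (tau' u))%N.

Definition is_stopping_time (n : nat)
    (M : {perm 'I_n} -> {perm 'I_n} -> 'I_n) : Prop :=
  forall (t : 'I_n) (sigma tau sigma' tau' : {perm 'I_n}),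
    same_relative_order t sigma tau sigma' tau' ->
    (M sigma tau = t <-> M sigma' tau' = t).

(* A randomized stopping algorithm: the internal randomness w in Omega selects
   a stopping time. A one-point Omega gives the deterministic ones. *)
Record stopping_algorithm (n : nat) (d : measure_display)
    (Omega : measurableType d) := StoppingAlgorithm {
  stop_time :> Omega -> {perm 'I_n} -> {perm 'I_n} -> 'I_n;
  stop_time_measurable : forall (sigma tau : {perm 'I_n}) (t : 'I_n),
    measurable [set w | stop_time w sigma tau = t]%classic;
  stop_time_stopping : forall w, is_stopping_time (stop_time w)
}.

Section privacy.
Context (R : realType) (n : nat) (d : measure_display).
Context (Omega : measurableType d) (P : probability Omega R).
Variable M : stopping_algorithm n Omega.

Definition selected (w : Omega) (sigma tau : {perm 'I_n}) : 'I_n :=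
  tau (M w sigma tau).

(* Pr[CM(sigma, tau) \in S] for tau uniform and independent of w ~ P. *)
Definition select_prob (sigma : {perm 'I_n}) (S : {set 'I_n}) : R :=
  (\sum_(tau : {perm 'I_n})
     fine (P [set w | selected w sigma tau \in S]%classic))
  / #|{perm 'I_n}|%:R.

Definition rank_prob (sigma : {perm 'I_n}) (i : 'I_n) : R :=
  select_prob sigma [set sigma i]%SET.

(* The standard convention 0 <= eps is part of the notion: for delta > 0 the
   inequalities alone can hold for some eps < 0. *)
Definition diff_private (l : nat) (hl : (0 < l)%N) (eps delta : R) : Prop :=
  0 <= eps /\
  forall (S : {set 'I_n}) (sigma rho : {perm 'I_n}),
    (swap_dist hl sigma rho <= 1)%N ->
    select_prob sigma S <= expR eps * select_prob rho S + delta.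

Definition has_gap (l : nat) (delta : R) (sigma : {perm 'I_n}) : Prop :=
  exists i j : 'I_n,
    [/\ i != j, (gap i j <= l)%N,
        rank_prob sigma j <= rank_prob sigma i
      & delta < rank_prob sigma i - rank_prob sigma j].

(* lne is -oo at nonpositive reals, so pairs with q_i <= delta, whose
   logarithm is undefined, do not contribute to the maximum. *)
Definition privacy_bound (l : nat) (delta : R) (sigma : {perm 'I_n}) : \bar R :=
  \big[maxe/-oo%E]_(p : 'I_n * 'I_n | (gap p.1 p.2 <= l)%N)
    lne (((rank_prob sigma p.1 - delta) / rank_prob sigma p.2)%:E).

End privacy.

(* Main.v *)
(* Whether M stops depends only on relative ranks, so relabelling the candidates
   in sigma and tau simultaneously is a measure-preserving bijection of the time
   orderings: the distribution q of the rank of the selected candidate does not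
   depend on sigma, and Pr[CM(sigma, tau) \in S] is the sum of the q_i with
   sigma i \in S. Two orderings at distance one differ by exchanging the
   candidates in positions i and j with |i - j| <= l, so their sums differ at
   most in the terms q_i and q_j. Privacy is thus equivalent to the finitely many
   inequalities q_i <= e^eps q_j + delta, and the best eps is the maximum of
   ln ((q_i - delta) / q_j). *)
Require Import Defs.
From HB Require Import structures.
From mathcomp Require Import all_boot all_order all_algebra all_fingroup.
From mathcomp Require Import all_classical all_reals all_analysis.
From mathcomp Require Import lra.

Set Implicit Arguments.
Unset Strict Implicit.
Unset Printing Implicit Defensive.

Import Order.TTheory GRing.Theory Num.Theory.

Local Open Scope ring_scope.

(** Conjugation by [rho] turns an exchange of two candidates after [rho] into an exchange of their
    positions before it. *)
Lemma swap_dist_le1P (l n : nat) (hl : (0 < l)%N) (sigma rho : {perm 'I_n}) :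
  (swap_dist hl sigma rho <= 1)%N <->
  sigma = rho \/
  exists i j, [/\ i != j, (gap i j <= l)%N & sigma = (tperm i j * rho)%g].
Proof.
rewrite /swap_dist; case: ex_minnP => k hk kmin; split.
  case: k hk {kmin} => [/eqP ->|[|//]]; first by left.
  case/existsP => _ /andP[/eqP ->] /existsP[a /existsP[b /and3P[ab hab /eqP ->]]] _.
  right; exists ((rho^-1)%g a), ((rho^-1)%g b); rewrite (inj_eq perm_inj).
  by split=> //; rewrite -tpermJ conjgE invgK !mulgA mulgKV.
case=> [E|[i [j [ij hij E]]]]; subst sigma.
  by rewrite (leq_trans (kmin 0%N _))//=.
apply: kmin; apply/existsP; exists rho; rewrite /= eqxx /=.
apply/existsP; exists (rho i); apply/existsP; exists (rho j).
rewrite (inj_eq perm_inj) ij !permK hij /=.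
by rewrite -tpermJ conjgE !mulgA mulgV mul1g.
Qed.

Section rank_probabilities.
Context (R : realType) (n : nat) (d : measure_display).
Context (Omega : measurableType d) (P : probability Omega R).
Variable M : stopping_algorithm n Omega.
Implicit Types (sigma rho tau : {perm 'I_n}) (S : {set 'I_n}).

Lemma measurable_selected sigma tau (i : 'I_n) :
  measurable [set w | selected M w sigma tau = i]%classic.
Proof.
rewrite (_ : [set _ | _]%classic =
    [set w | M w sigma tau = (tau^-1)%g i]%classic).
  exact: stop_time_measurable.
apply/seteqP; split => w; rewrite /selected /=.
  by move=> <-; rewrite permK.
by move=> ->; rewrite permKV.
Qed.

(** For each fixed [tau], the events of selecting rank [i] are disjoint, so finite additivity
    applies. *)
Lemma select_probE sigma S :
  select_prob P M sigma S = \sum_(i | sigma i \in S) rank_prob P M sigma i.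
Proof.
rewrite /rank_prob /select_prob -mulr_suml exchange_big /=; congr (_ / _).
apply: eq_bigr => tau _.
pose F (i : 'I_n) : set Omega := [set w | selected M w sigma tau = sigma i]%classic.
have mF (i : 'I_n) : measurable (F i) by exact: measurable_selected.
have tF : trivIset setT F.
  by move=> i j _ _ [w [Fi Fj]]; apply: (@perm_inj _ sigma); rewrite -Fi.
have -> : [set w | selected M w sigma tau \in S]%classic =
    \big[setU/set0]_(i < n | sigma i \in S) F i.
  rewrite -(bigcup_pred [pred i | sigma i \in S]); apply/seteqP; split => w /=.
    move=> wS; exists ((sigma^-1)%g (selected M w sigma tau));
      by rewrite /F /= ?inE permKV.
  by case=> i; rewrite /F /= inE => iS ->.
rewrite measure_bigsetU_ord//; apply: EFin_inj.
rewrite -sumEFin fineK; last first.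
  by apply/sum_fin_numP => i _ _; exact: fin_num_measure.
apply: eq_bigr => i _.
have -> : [set w | selected M w sigma tau \in [set sigma i]%SET]%classic = F i.
  by apply/seteqP; split => w; rewrite /F /= inE => /eqP.
by rewrite fineK//; exact: fin_num_measure.
Qed.

Lemma rank_prob_ordering sigma rho (i : 'I_n) :
  rank_prob P M sigma i = rank_prob P M rho i.
Proof.
rewrite /rank_prob /select_prob; congr (_ / _).
(* This substitution replaces each arriving candidate by the one holding the same rank in [rho]. *)
rewrite [RHS](reindex_inj (mulIg (sigma^-1 * rho)%g)) /=.
apply: eq_bigr => tau _; congr (fine (P _)).
have MM w : M w rho (tau * (sigma^-1 * rho))%g = M w sigma tau.
  have /stop_time_stopping st : same_relative_order (M w sigma tau)
      sigma tau rho (tau * (sigma^-1 * rho))%g.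
    by move=> s u _ _; rewrite !permM !permK.
  by apply/st.
apply/seteqP; split => w /=; rewrite /selected MM !permM !inE.
  by move=> /eqP ->; rewrite permK.
by rewrite (inj_eq perm_inj) => /eqP <-; rewrite permKV.
Qed.

Lemma rank_prob_ge0 sigma (i : 'I_n) : 0 <= rank_prob P M sigma i.
Proof.
by rewrite divr_ge0 ?ler0n// sumr_ge0// => tau _; exact: fine_ge0.
Qed.

(** The reference ordering [sigma0] can be arbitrary, since rank probabilities are the same for all
    orderings. *)
Lemma diff_privateP (l : nat) (hl : (0 < l)%N) (eps delta : R) sigma0 :
    0 <= delta ->
  diff_private P M hl eps delta <->
  0 <= eps /\ forall i j : 'I_n, (gap i j <= l)%N ->
    rank_prob P M sigma0 i <= expR eps * rank_prob P M sigma0 j + delta.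
Proof.
move=> delta0; have q0 := rank_prob_ge0 sigma0.
set q := rank_prob P M sigma0 in q0 *.
have prE sigma S : select_prob P M sigma S = \sum_(k | sigma k \in S) q k.
  by rewrite select_probE; apply: eq_bigr => k _; exact: rank_prob_ordering.
split=> -[eps0 H]; split=> //.
  move=> i j hij; have [<-|ij] := eqVneq i j.
    by have := H [set sigma0 i] sigma0 sigma0; apply; apply/swap_dist_le1P; left.
  have dist1 : (swap_dist hl sigma0 (tperm i j * sigma0)%g <= 1)%N.
    apply/swap_dist_le1P; right; exists i, j; split=> //.
    by rewrite mulgA tperm2 mul1g.
  (* Test privacy on a singleton: its candidate has rank [i] in [sigma0] and rank [j] after the
     exchange. *)
  have := H [set sigma0 i] _ _ dist1; rewrite -/(rank_prob P M sigma0 i) -/q.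
  rewrite [in X in _ * X](_ : sigma0 i = (tperm i j * sigma0)%g j); last first.
    by rewrite permM tpermR.
  rewrite -/(rank_prob P M (tperm i j * sigma0)%g j).
  by rewrite (rank_prob_ordering _ sigma0).
have E1 : 1 <= expR eps by rewrite -expR0 ler_expR.
have leE x : 0 <= x -> x <= expR eps * x by move=> x0; rewrite ler_peMl.
have sum0 (A : pred 'I_n) : 0 <= \sum_(k | A k) q k by apply: sumr_ge0.
move=> S sigma rho /swap_dist_le1P[->|[i [j [ij hij ->]]]]; rewrite !prE.
  by rewrite (le_trans (leE _ _)) ?lerDl.
rewrite !(big_mkcond (fun k => _ \in S)) /=.
have split2 (F : 'I_n -> R) :
    \sum_k F k = F i + F j + \sum_(k | (k != i) && (k != j)) F k.
  by rewrite (bigD1 i)//= (bigD1 j)/= 1?eq_sym// addrA.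
rewrite !split2 !permM tpermL tpermR.
under eq_bigr => k /andP[ki kj] do rewrite permM tpermD 1?eq_sym//.
rewrite -big_mkcondr /=.
(* [r] collects the ranks other than [i] and [j], whose contribution is the same for both
   orderings. *)
set r := \sum_(_ | _) _.
have r0 : 0 <= r by exact: sum0.
have := H i j hij; have := H j i; rewrite {1}/gap distnC => /(_ hij).
have := leE _ r0; have := leE _ (q0 i); have := leE _ (q0 j).
(* If exactly one of the two candidates lies in [S], a pairwise inequality is needed; otherwise both
   sums agree and [1 <= expR eps] suffices. *)
by case: (rho i \in S); case: (rho j \in S); rewrite ?mulrDr ?mulr0; lra.
Qed.

End rank_probabilities.

(** Tightness concerns the given [M] itself: it is private at the bound, or at [0] when there is no
    gap. *)
Theorem theorem2 (R : realType) (n l : nat) (hl : (0 < l)%N) (hln : (l < n)%N)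
    (delta : R) (hdelta : 0 <= delta)
    (d : measure_display) (Omega : measurableType d)
    (P : probability Omega R) (M : stopping_algorithm n Omega)
    (sigma : {perm 'I_n})
    (hq : forall i : 'I_n, 0 < rank_prob P M sigma i < 1) :
  (forall eps : R, diff_private P M hl eps delta ->
     (has_gap P M l delta sigma ->
        (privacy_bound P M l delta sigma <= eps%:E)%E) /\
     (~ has_gap P M l delta sigma -> 0 <= eps)) /\
  (has_gap P M l delta sigma ->
     exists2 eps : R, eps%:E = privacy_bound P M l delta sigma
       & diff_private P M hl eps delta) /\
  (~ has_gap P M l delta sigma -> diff_private P M hl 0 delta).
Proof.
have q_gt0 i : 0 < rank_prob P M sigma i by have /andP[] := hq i.
have bound_le (eps : R) : (privacy_bound P M l delta sigma <= eps%:E)%E <->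
    forall i j : 'I_n, (gap i j <= l)%N ->
      rank_prob P M sigma i <= expR eps * rank_prob P M sigma j + delta.
  have term i j : (lne (((rank_prob P M sigma i - delta) /
      rank_prob P M sigma j)%:E) <= eps%:E)%E =
      (rank_prob P M sigma i <= expR eps * rank_prob P M sigma j + delta).
    rewrite -lerBlDr -ler_pdivrMr//; set x := _ / _.
    (* For [x <= 0] the logarithm is [-oo] and both inequalities hold trivially. *)
    have [x0|x0] := leP x 0.
      by rewrite le0_lneNy ?lee_fin// leNye (le_trans x0)// expR_ge0.
    by rewrite lne_EFin// lee_fin -ler_expR lnK.
  split=> [/bigmax_leP[_ H] i j hij|H]; first by have := H (i, j) hij; rewrite term.
  by apply/bigmax_leP; split=> [|[i j] /= hij]; rewrite ?leNye// term H.
split; last split.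
- by move=> eps /(diff_privateP _ _ _ _ sigma hdelta)[eps0 /bound_le].
- case=> i [j [_ hij _ gt_delta]].
  (* The gap pair has ratio above 1, hence a positive logarithm; this also yields the required
     [0 <= eps]. *)
  have bound_gt0 : (0 < privacy_bound P M l delta sigma)%E.
    rewrite ltNge; apply/negP => /bigmax_leP[_ /(_ (i, j) hij)].
    apply/negP; rewrite -ltNge lne_gt0 lte_fin ltr_pdivlMr// mul1r.
    by rewrite ltrBrDl -ltrBrDr.
  have bound_fin : privacy_bound P M l delta sigma \is a fin_num.
    rewrite fin_numElt (lt_trans _ bound_gt0) ?ltNyr//=.
    apply/bigmax_ltP; split=> // -[a b] _.
    by rewrite /lne; case: ifP => // _; exact: ltry.
  exists (fine (privacy_bound P M l delta sigma)); first by rewrite fineK.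
  apply/(diff_privateP _ _ _ _ sigma hdelta); split.
    by rewrite fine_ge0// ltW.
  by apply/bound_le; rewrite fineK.
(* A pair violating the inequality at [eps = 0] would itself be a gap. *)
- move=> no_gap; apply/(diff_privateP _ _ _ _ sigma hdelta); split=> // i j hij.
  rewrite expR0 mul1r; apply: contra_notT no_gap; rewrite -ltNge => lt.
  have ij : rank_prob P M sigma j < rank_prob P M sigma i.
    by rewrite (le_lt_trans _ lt)// lerDl.
  exists i, j; split=> //; [|exact: ltW|by rewrite ltrBrDl].
  by apply: contraTneq ij => ->; rewrite ltxx.
Qed.
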